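(* Let $d>1$ and $n$ be positive integers with $d\mid n$. The labeling $\lambda$ of the cover relations of $\Pi_n^d$ defined below is a dual $EL$-labeling of $\Pi_n^d$: for every interval $[x,y]$ of $\Pi_n^d$ there is a unique maximal chain $y=x_0\gtrdot x_1\gtrdot\dots\gtrdot x_m=x$ with $\lambda(x_0\gtrdot x_1)\le\lambda(x_1\gtrdot x_2)\le\dots\le\lambda(x_{m-1}\gtrdot x_m)$, and its label sequence (read from $y$ down to $x$) is lexicographically first among all maximal chains of $[x,y]$.
   Context: $\Pi_n^d$ (the $d$-divisible partition lattice) is the set of partitions of $[n]=\{1,\dots,n\}$ other than the one-block partition in which every block has size divisible by $d$, ordered by refinement, with a top element $\hat1$ (the one-block partition $[n]$) and a bottom element $\hat0$ adjoined. Labeling: if $y\gtrdot z$ is a cover relation with $z\neq\hat0$, then $y$ is obtained from $z$ by merging two blocks $B_1,B_2$ of $z$ with $\max B_1<\max B_2$; set $\lambda(y\gtrdot z)=-\max B_1$ if $\max B_1<\min B_2$, and $\lambda(y\gtrdot z)=\max B_1$ otherwise. Set $\lambda(y\gtrdot\hat0)=0$. Labels are compared as integers. *)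

(* Defs.v *)
From HB Require Import structures.
From mathcomp Require Import all_boot all_order all_algebra.
Set Implicit Arguments.
Unset Strict Implicit.
Unset Printing Implicit Defensive.
Import Order.TTheory GRing.Theory Num.Theory.

Section DualEL.
Context {disp : Order.disp_t} {T : finPOrderType disp}.
Implicit Types x y z : T.

Definition covers y z : bool := (z < y)%O && [forall t, ~~ (z < t < y)%O].

(* A maximal chain of [x, y] is read downwards, y = x_0 > x_1 > ... > x_m = x,
   and is represented by the sequence c = [:: x_1; ...; x_m]; y is implicit. *)
Definition maximal_chain x y (c : seq T) : bool :=
  path covers y c && (last y c == x).

Definition chain_labels (lam : T -> T -> int) y (c : seq T) : seq int :=
  pairmap lam y c.

Definition increasing_chain (lam : T -> T -> int) y (c : seq T) : bool :=
  sorted (fun a b : int => (a <= b)%R) (chain_labels lam y c).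

(* Only the values lam y z with y covering z are ever used. *)
Definition dual_EL_labeling (lam : T -> T -> int) : Prop :=
  forall x y, (x <= y)%O ->
  exists c : seq T,
    [/\ maximal_chain x y c /\ increasing_chain lam y c,
        (forall c', maximal_chain x y c' -> increasing_chain lam y c' -> c' = c)
      & (forall c', maximal_chain x y c' -> c' != c ->
           (chain_labels lam y c < chain_labels lam y c' :> seqlexi int)%O)].

End DualEL.

(* The element i : 'I_n stands for the integer i.+1 of [n] = {1, ..., n}. *)
Definition block_max n (B : {set 'I_n}) : nat := \max_(i in B) i.+1.
(* The default value n is harmless for a nonempty block. *)
Definition block_min n (B : {set 'I_n}) : nat := \big[minn/n]_(i in B) i.+1.

(* When n > 0 and d %| n this includes the one-block partition. *)
Definition is_ddpart d n (P : {set {set 'I_n}}) : bool :=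
  partition P [set: 'I_n] && [forall B in P, d %| #|B|].

Record ddpart d n := DDPart {
  ddblocks :> {set {set 'I_n}};
  _ : is_ddpart d ddblocks
}.

HB.instance Definition _ d n := [isSub for @ddblocks d n].
HB.instance Definition _ d n := [Finite of ddpart d n by <:].

Definition refines n (P Q : {set {set 'I_n}}) : bool :=
  [forall B in P, exists C in Q, B \subset C].

(* None is the adjoined bottom element; the top element is the one-block
   partition. *)
Definition ddlattice d n := option (ddpart d n).

HB.instance Definition _ d n := Finite.copy (ddlattice d n) (option (ddpart d n)).

Definition ddlattice_le d n (x y : ddlattice d n) : bool :=
  match x, y with
  | None, _ => true
  | Some _, None => false
  | Some P, Some Q => refines P Q
  end.

Lemma refinesP n (P Q : {set {set 'I_n}}) :
  reflect (forall B, B \in P -> exists2 C, C \in Q & B \subset C) (refines P Q).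
Proof.
apply: (iffP forallP) => [H B BP | H B].
  by have /implyP/(_ BP)/existsP[C /andP[CQ BC]] := H B; exists C.
by apply/implyP => /H[C CQ BC]; apply/existsP; exists C; rewrite CQ.
Qed.

Lemma refines_anti_sub n (P Q : {set {set 'I_n}}) D :
  partition P D -> refines P Q -> refines Q P -> P \subset Q.
Proof.
case/and3P=> _ tP P0 /refinesP PQ /refinesP QP; apply/subsetP => B BP.
have [C CQ BC] := PQ B BP; have [B' B'P CB'] := QP C CQ.
have /set0Pn[x xB] : B != set0 by apply: contraNneq P0 => <-.
have xB' : x \in B' by rewrite (subsetP CB')// (subsetP BC).
have eB : B' = B by rewrite -(def_pblock tP BP xB) (def_pblock tP B'P xB').
suff -> : B = C by [].
by apply/eqP; rewrite eqEsubset BC -eB.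
Qed.

Lemma ddlattice_le_refl d n : reflexive (@ddlattice_le d n).
Proof. by case=> //= P; apply/refinesP => B BP; exists B. Qed.

Lemma ddlattice_le_anti d n : antisymmetric (@ddlattice_le d n).
Proof.
case=> [[P hP]|] [[Q hQ]|] //= /andP[PQ QP].
congr Some; apply: val_inj => /=; apply/eqP; rewrite eqEsubset.
case/andP: (hP) => pP _; case/andP: (hQ) => pQ _.
by rewrite (refines_anti_sub pP PQ QP) (refines_anti_sub pQ QP PQ).
Qed.

Lemma ddlattice_le_trans d n : transitive (@ddlattice_le d n).
Proof.
case=> [Q|] [P|] [R|] //= /refinesP PQ /refinesP QR.
apply/refinesP => B /PQ[C /QR[E ER CE] BC].
by exists E => //; apply: subset_trans CE.
Qed.

Fact ddlattice_display : Order.disp_t. Proof. exact: Order.Disp tt tt. Qed.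

HB.instance Definition _ d n :=
  Order.Le_isPOrder.Build ddlattice_display (ddlattice d n)
    (@ddlattice_le_refl d n) (@ddlattice_le_anti d n) (@ddlattice_le_trans d n).

Definition is_merge n (P Q : {set {set 'I_n}}) (B1 B2 : {set 'I_n}) : bool :=
  [&& B1 \in Q, B2 \in Q, block_max B1 < block_max B2
    & P == (B1 :|: B2) |: (Q :\ B1 :\ B2)].

(* The label of the cover relation in which y covers z. The pair picked below
   is then the unique one; off the cover relations the value is a default 0. *)
Definition ddlabel d n (y z : ddlattice d n) : int :=
  match y, z with
  | Some P, Some Q =>
      match [pick B : {set 'I_n} * {set 'I_n} | is_merge P Q B.1 B.2] with
      | Some (B1, B2) =>
          if block_max B1 < block_min B2 then (- Posz (block_max B1))%R
          else Posz (block_max B1)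
      | None => 0%R
      end
  | Some _, None => 0%R
  | None, _ => 0%R
  end.

(* Main.v *)
(* Fix x <= y and let z be a cover of least label among the elements of [x, y]
   covered by y. The labeling is dual EL as soon as, always within [x, y]:
   z is the only element with that label, every label below z is at least that
   of (y, z), and every other element t covered by y covers some u with
   lam t u < lam y t. By induction the increasing chain below t starts with the
   least label there, so the last condition makes every increasing chain of
   [x, y] start with z.
   Going down from a partition splits a block B into D and B \ D, where D is a
   union of blocks of x (or, if x is the bottom, has size divisible by d); the
   label is the smaller of the two maxima, with a minus sign if D lies entirely
   before B \ D. If the least label is negative, with B split into I < J, an
   increasing chain cannot cut B otherwise first, since the pieces that meet
   both I and J must later be cut with a negative label (if x is the bottom and
   the first label is positive, then a negative label or the final 0 must
   follow). If the least label is positive, then no initial segment can be split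
   off and the lower part I is the block of x with the least maximum, which can
   be split off at any later time. *)
Require Import Defs.
From mathcomp Require Import all_boot all_order all_algebra zify.
Set Implicit Arguments.
Unset Strict Implicit.
Unset Printing Implicit Defensive.
Import Order.TTheory GRing.Theory Num.Theory.

(** * A local criterion for dual EL-labelings *)

Section LocalCriterion.
Context {disp : Order.disp_t} {T : finPOrderType disp}.
Implicit Types x y z : T.

Definition cover_in x y z : bool := covers y z && (x <= z)%O.

Definition least_step (lam : T -> T -> int) x y z : Prop :=
  cover_in x y z /\ forall t, cover_in x y t -> (lam y z <= lam y t)%R.

Lemma covers_lt y z : covers y z -> (z < y)%O.
Proof. by case/andP. Qed.

Lemma covers_between y z t : covers y z -> (z < t)%O -> (t < y)%O -> False.
Proof. by case/andP=> _ /forallP/(_ t)/negP H zt ty; apply: H; rewrite zt. Qed.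

Lemma exists_cover_in x y : (x < y)%O -> exists z, cover_in x y z.
Proof.
move=> xy; pose P z := (x <= z)%O && (z < y)%O.
have Px : P x by rewrite /P lexx.
(* An element of [[x, y)] with the most elements below it is covered by [y]. *)
case: (@arg_maxnP _ x P (fun z => #|[set t | (t <= z)%O]|) Px) => z /andP[xz zy] zmax.
exists z; rewrite /cover_in xz andbT /covers zy; apply/forallP => t.
apply/negP => /andP[zt ty].
have := zmax t; rewrite /P ty (le_trans xz (ltW zt)) => /(_ isT).
apply/negP; rewrite -ltnNge; apply/proper_card/properP; split.
  by apply/subsetP => u; rewrite !inE => /le_trans; apply; apply: ltW.
by exists t; rewrite inE ?lexx// lt_geF.
Qed.

Lemma exists_least_step lam x y : (x < y)%O -> exists z, least_step lam x y z.
Proof.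
case/exists_cover_in=> z0 Pz0.
case: (@arg_minP _ _ _ z0 (cover_in x y) (lam y) Pz0) => z Pz zmin.
by exists z.
Qed.

Lemma maximal_chain_le x y c : maximal_chain x y c -> (x <= y)%O.
Proof.
elim: c y => [|z c IHc] y; first by rewrite /maximal_chain /= => /eqP ->.
rewrite /maximal_chain /= -andbA => /andP[/covers_lt zy zc].
by apply: le_trans (ltW zy); apply: IHc.
Qed.

Lemma maximal_chain_cons x y z c :
  maximal_chain x y (z :: c) = cover_in x y z && maximal_chain x z c.
Proof.
rewrite /cover_in -andbA {1}/maximal_chain /= -andbA; case: (covers y z) => //=.
rewrite -/(maximal_chain x z c); case: (boolP (maximal_chain x z c)) => //.
  by move/maximal_chain_le => ->.
by rewrite andbF.
Qed.

Lemma maximal_chain_self x c : maximal_chain x x c -> c = [::].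
Proof.
case: c => // z c; rewrite maximal_chain_cons => /andP[/andP[/covers_lt zx xz] _].
by rewrite (lt_geF zx) in xz.
Qed.

Lemma maximal_chain_nil x y : maximal_chain x y [::] -> y = x.
Proof. by rewrite /maximal_chain /= => /eqP. Qed.

Lemma increasing_chain_cons lam y z t c :
  increasing_chain lam y (z :: t :: c)
  = (lam y z <= lam z t)%R && increasing_chain lam z (t :: c).
Proof. by []. Qed.

Lemma chain_labels_lt_cons lam y z c z' c' :
  (chain_labels lam y (z :: c) < chain_labels lam y (z' :: c') :> seqlexi int)%O =
  (lam y z <= lam y z')%O && ((lam y z' <= lam y z)%O
     ==> (chain_labels lam z c < chain_labels lam z' c' :> seqlexi int)%O).
Proof. exact: ltxi_cons. Qed.

Lemma dual_EL_of_least_step (lam : T -> T -> int) :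
  (forall x y z, least_step lam x y z ->
    [/\ (forall t, cover_in x y t -> lam y t = lam y z -> t = z),
        (forall t, cover_in x z t -> (lam y z <= lam z t)%R)
      & (forall t, cover_in x y t -> t != z ->
           exists2 u, cover_in x t u & (lam t u < lam y t)%R)]) ->
  dual_EL_labeling lam.
Proof.
(* Induction on the number of elements strictly below [y]. *)
move=> H x y; move: {2}_.+1 (ltnSn #|[set t | (t < y)%O]|) => k.
elim: k y => // k IHk y yk xy.
have lower z : (z < y)%O -> [set t | (t < z)%O] \proper [set t | (t < y)%O].
  move=> zy; apply/properP; split; last by exists z; rewrite inE ?ltxx.
  by apply/subsetP => t; rewrite !inE => /lt_trans; apply.
have {IHk}IH z (zy : (z < y)%O) (xz : (x <= z)%O) := IHk z
  (leq_trans (proper_card (lower z zy)) yk) xz.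
case: (eqVneq x y) => [<-|neq_xy].
  exists [::]; split; first by rewrite /maximal_chain /= eqxx.
    by move=> c' /maximal_chain_self.
  by move=> c' /maximal_chain_self ->; rewrite eqxx.
have {xy neq_xy}xy : (x < y)%O by rewrite lt_neqAle neq_xy.
have [z [yz zmin]] := exists_least_step lam xy.
have [inj incr descent] := H _ _ _ (conj yz zmin).
have [/covers_lt zy xz] := andP yz.
have [c [[mc ic] uc lc]] := IH z zy xz.
exists (z :: c); split.
- rewrite maximal_chain_cons yz mc; split=> //.
  case: c mc ic {uc lc} => // t c; rewrite maximal_chain_cons => /andP[zt _] ic.
  by rewrite increasing_chain_cons ic incr.
- case=> [/maximal_chain_nil yx|t c']; first by rewrite yx ltxx in xy.
  rewrite maximal_chain_cons => /andP[yt mc'] ic'.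
  case: (eqVneq t z) => [tz|tz].
    move: ic' mc'; rewrite {}tz => ic' mc'; congr cons; apply: uc => //.
    by case: c' ic' {mc'} => // u c' /andP[].
  (* Suppose the chain starts with [t] other than [z]. By induction its increasing tail is
     lexicographically first below [t], so it starts with a label at most [lam t u], hence below
     [lam y t], and the chain does not increase. *)
  have [u tu lu] := descent t yt tz.
  have [/covers_lt ty xt] := andP yt; have [/covers_lt ut xu] := andP tu.
  have [c1 [_ uc1 lc1]] := IH t ty xt.
  have [c2 [[mc2 _] _ _]] := IH u (lt_trans ut ty) xu.
  case: c' mc' ic' => [/maximal_chain_nil tx|v c' mc'].
    by have := lt_geF ut; rewrite tx xu.
  rewrite increasing_chain_cons => /andP[lv ic'].
  have e1 := uc1 _ mc' ic'; rewrite -{}e1 in lc1.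
  have mu : maximal_chain x t (u :: c2) by rewrite maximal_chain_cons tu mc2.
  have lvu : (lam t v <= lam t u)%R.
    case: (eqVneq (u :: c2) (v :: c')) => [[-> _] //|neq].
    by have := lc1 _ mu neq; rewrite chain_labels_lt_cons => /andP[].
  by have := le_lt_trans (le_trans lv lvu) lu; rewrite ltxx.
- case=> [/maximal_chain_nil yx|t c']; first by rewrite yx ltxx in xy.
  rewrite maximal_chain_cons => /andP[yt mc'] neq.
  (* A first label above the least one decides the comparison; a tie forces [t] to be [z] and leaves
     the tails to the induction. *)
  rewrite chain_labels_lt_cons zmin //=; apply/implyP => ltz.
  have tz : t = z by apply: inj => //; apply/eqP; rewrite eq_le ltz zmin.
  move: mc' neq; rewrite {}tz eqseq_cons eqxx /=; exact: lc.
Qed.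

End LocalCriterion.

(** * Maxima, minima and splitting of blocks *)

Section Blocks.
Context {n : nat}.
Implicit Types (i j : 'I_n) (B D E : {set 'I_n}) (P Q : {set {set 'I_n}}).

Lemma mem_ltn_block_max B i : i \in B -> i < block_max B.
Proof. exact: (@leq_bigmax_cond _ (mem B) (fun i : 'I_n => i.+1)). Qed.

Lemma block_max_attained B :
  B != set0 -> exists2 i, i \in B & block_max B = i.+1.
Proof.
case/set0Pn=> i iB; have B0 : 0 < #|B| by apply/card_gt0P; exists i.
have [j jB eB] := @eq_bigmax_cond _ (mem B) (fun i : 'I_n => i.+1) B0.
by exists j.
Qed.

Lemma block_max_mono D B : D \subset B -> block_max D <= block_max B.
Proof.
move=> /subsetP DB; apply/bigmax_leqP => i iD; exact/mem_ltn_block_max/DB.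
Qed.

Lemma block_maxU D E :
  block_max (D :|: E) = maxn (block_max D) (block_max E).
Proof.
apply/eqP; rewrite eqn_leq geq_max !block_max_mono ?subsetUl ?subsetUr// !andbT.
apply/bigmax_leqP => i; rewrite leq_max inE.
by case/orP=> /mem_ltn_block_max ->; rewrite ?orbT.
Qed.

Lemma block_min_leq B i : i \in B -> block_min B <= i.+1.
Proof.
move=> iB; rewrite /block_min; elim: (index_enum _) (mem_index_enum i) => // j s IHs.
rewrite inE big_cons => /predU1P[<-|/IHs le]; first by rewrite iB geq_minl.
by case: ifP => // _; rewrite geq_min le orbT.
Qed.

Lemma ltn_max_minP D E : D != set0 -> E != set0 ->
  reflect (forall i j, i \in D -> j \in E -> i < j) (block_max D < block_min E).
Proof.
move=> D0 E0; apply: (iffP idP) => [lt i j iD jE|lt].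
  by have := mem_ltn_block_max iD; have := block_min_leq jE; lia.
have [k kD ->] := block_max_attained D0; have /set0Pn[j0 j0E] := E0.
rewrite /block_min; apply: (big_ind (fun m => k.+1 < m)) => [||j jE].
(* The default value [n] exceeds [k.+1], because [E] has an element [j0] above [k]. *)
- by have := lt k j0 kD j0E; have := ltn_ord j0; lia.
- by move=> a b; rewrite leq_min => -> ->.
- exact: lt.
Qed.

(** Built by adjoining the least remaining element of [B], [k] times. *)
Lemma exists_initial_segment k B : k <= #|B| -> exists D,
  [/\ D \subset B, #|D| = k & forall i j, i \in D -> j \in B :\: D -> i < j].
Proof.
elim: k => [|k IHk] kB.
  by exists set0; rewrite sub0set cards0; split=> // i j; rewrite inE.
have [D [DB cD lt]] := IHk (ltnW kB).
have /set0Pn[i0 i0E] : B :\: D != set0.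
  by rewrite -card_gt0 cardsD (setIidPr DB) cD subn_gt0.
case: (@arg_minnP _ i0 (mem (B :\: D)) val i0E) => i iE imin.
have [iB iD] : i \in B /\ i \notin D by case/setDP: iE.
exists (i |: D); split.
- by rewrite subUset sub1set iB.
- by rewrite cardsU1 iD cD.
- move=> a b /setU1P[->|aD]; rewrite !inE negb_or -andbA => /and3P[bi bD bB].
    by rewrite ltn_neqAle imin ?inE ?bD// eq_sym val_eqE bi.
  by apply: lt; rewrite ?inE ?bD.
Qed.

(* The label of the merge of D and E, assuming block_max D < block_max E. *)
Definition split_label D E : int :=
  if block_max D < block_min E then (- Posz (block_max D))%R
  else Posz (block_max D).

Definition split_block P B D : {set {set 'I_n}} :=
  D |: ((B :\: D) |: (P :\ B)).

Lemma split_blockC P B D : D \subset B -> split_block P B (B :\: D) = split_block P B D.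
Proof.
move=> DB; rewrite /split_block setDDr setDv set0U (setIidPr DB).
by rewrite setUCA.
Qed.

Section Partition.
Variables (P : {set {set 'I_n}}) (pP : partition P [set: 'I_n]).

Lemma same_block B C i : B \in P -> C \in P -> i \in B -> i \in C -> B = C.
Proof.
have tP := partition_trivIset pP => BP CP iB iC.
by rewrite -(def_pblock tP BP iB) (def_pblock tP CP iC).
Qed.

Lemma block_of i : exists2 B, B \in P & i \in B.
Proof.
have iP : i \in cover P by rewrite (cover_partition pP) inE.
by exists (pblock P i); [apply: pblock_mem | rewrite mem_pblock].
Qed.

Lemma block_neq0 B : B \in P -> B != set0.
Proof. exact: partition_neq0 pP. Qed.

Lemma partition_split B D : B \in P -> D \subset B -> D != set0 -> D != B ->
  partition (split_block P B D) [set: 'I_n].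
Proof.
move=> BP DB D0 DneqB.
have E0 : B :\: D != set0.
  by rewrite setD_eq0; apply: contra DneqB => BD; rewrite eqEsubset DB.
have p1 := partitionU1 (partitionD1 pP BP) E0; rewrite !setTD in p1.
rewrite /split_block.
have <- : D :|: (B :\: D :|: ~: B) = setT.
  apply/setP => i; rewrite !inE; have := subsetP DB i.
  by case: (i \in D) => //=; case: (i \in B).
apply: partitionU1 => //; first apply: p1.
  rewrite -setI_eq0; apply/eqP/setP => i; rewrite !inE.
  by case: (i \in B); rewrite ?andbF.
rewrite -setI_eq0; apply/eqP/setP => i; rewrite !inE; have := subsetP DB i.
by case: (i \in D) => //=; case: (i \in B) => // /(_ isT).
Qed.

Lemma in_split B D C : C \in split_block P B D =
  [|| C == D, C == B :\: D | (C != B) && (C \in P)].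
Proof. by rewrite !inE. Qed.

Lemma notin_split B D : B \in P -> D \subset B -> D != set0 -> D != B ->
  B \notin split_block P B D.
Proof.
move=> BP DB D0 DneqB; rewrite in_split eq_sym (negbTE DneqB) eqxx /= orbF.
have /set0Pn[i iD] := D0; apply/eqP => /setP/(_ i).
by rewrite !inE iD (subsetP DB).
Qed.

Lemma notin_of_split B D : B \in P -> D \subset B -> D != set0 -> D != B -> D \notin P.
Proof.
move=> BP DB /set0Pn[j jD]; apply: contraNN => DP; apply/eqP.
exact: (same_block DP BP jD (subsetP DB j jD)).
Qed.

End Partition.
End Blocks.

(** * Cover relations as block splittings, and their labels *)

Section Lattice.
Context {d n : nat}.
Implicit Types (i j : 'I_n) (A B C D E : {set 'I_n}) (P Q X : ddpart d n).
Implicit Types (x y z : ddlattice d n).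

Definition bot : ddlattice d n := None.
Definition elt P : ddlattice d n := Some P.

(** Whether the pieces are admissible above a given [x] is left to [saturated]. *)
Definition cut P B D := [&& B \in ddblocks P, D \subset B, D != set0 & D != B].

(** What keeps the split of a block at [D] above [x], by [le_split]. *)
Definition saturated x D : bool :=
  if x is Some X then [forall A in ddblocks X, (A \subset D) || [disjoint A & D]]
  else d %| #|D|.

Lemma ddpartP P : partition P [set: 'I_n].
Proof. by case: P => P /= /andP[]. Qed.

Lemma ddpart_dvd P B : B \in ddblocks P -> d %| #|B|.
Proof. by case: P => P /= /andP[_ /forallP/(_ B)/implyP]. Qed.

Lemma elt_le P Q : (elt P <= elt Q)%O = refines P Q.
Proof. by []. Qed.

Lemma bot_le x : (bot <= x)%O.
Proof. by []. Qed.

Lemma bot_lt P : (bot < elt P)%O.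
Proof. by []. Qed.

Lemma elt_inj P Q : ddblocks P = ddblocks Q -> elt P = elt Q.
Proof. by move=> eq; congr Some; apply: val_inj. Qed.

Lemma cutC P B D : cut P B D -> cut P B (B :\: D).
Proof.
case/and4P=> BP DB D0 DneqB; rewrite /cut BP subsetDl /=.
apply/andP; split.
  by rewrite setD_eq0; apply: contra DneqB => BD; rewrite eqEsubset DB.
have /set0Pn[i iD] := D0; apply/eqP => /setP/(_ i).
by rewrite !inE iD (subsetP DB).
Qed.

Lemma saturatedP X D : reflect
  (forall A, A \in ddblocks X -> A \subset D \/ [disjoint A & D])
  (saturated (elt X) D).
Proof.
apply: (iffP forallP) => [sat A AX|sat A].
  by have /implyP/(_ AX)/orP := sat A.
by apply/implyP => /sat/orP.
Qed.

Lemma saturated_block_sub X D A i :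
  saturated (elt X) D -> A \in ddblocks X -> i \in A -> i \in D -> A \subset D.
Proof.
move=> /saturatedP sat AX iA iD; case: (sat A AX) => // /pred0P/(_ i) /=.
by rewrite iA iD.
Qed.

Lemma saturated_of_blocks X D : 
  (forall A i, A \in ddblocks X -> i \in A -> i \in D -> A \subset D) ->
  saturated (elt X) D.
Proof.
move=> sat; apply/saturatedP => A AX; case: (boolP [disjoint A & D]); first by right.
by case/pred0Pn=> i /= /andP[iA iD]; left; apply: sat AX iA iD.
Qed.

(** [D] is the disjoint union of the blocks of [X] that it contains. *)
Lemma saturated_dvd x D : saturated x D -> d %| #|D|.
Proof.
case: x => [X|//] sat.
have -> : D = cover [set A in ddblocks X | A \subset D].
  apply/setP => i; apply/idP/bigcupP => [iD|[A]]; last first.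
    by rewrite inE => /andP[_ /subsetP AD] /AD.
  have [A AX iA] := block_of (ddpartP X) i; exists A => //.
  by rewrite inE AX (saturated_block_sub sat AX iA iD).
have /eqP <- : trivIset [set A in ddblocks X | A \subset D].
  apply: trivIsetS (partition_trivIset (ddpartP X)).
  by apply/subsetP => A; rewrite inE => /andP[].
by apply: dvdn_sum => A; rewrite inE => /andP[/ddpart_dvd].
Qed.

Lemma saturatedD x D E : E \subset D ->
  saturated x D -> saturated x E -> saturated x (D :\: E).
Proof.
move=> ED; case: x => [X|] satD satE; last first.
  by rewrite /= cardsD (setIidPr ED) dvdn_sub.
apply: saturated_of_blocks => A i AX iA; rewrite inE => /andP[iE iD].
rewrite subsetD (saturated_block_sub satD AX iA iD) /=.
case/saturatedP/(_ A AX): satE => // /subsetP/(_ i iA) iE'.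
by rewrite iE' in iE.
Qed.

Lemma saturatedU x D E : [disjoint D & E] ->
  saturated x D -> saturated x E -> saturated x (D :|: E).
Proof.
move=> dDE; case: x => [X|] satD satE; last first.
  by move: (leq_card_setU D E) => /= [_]; rewrite dDE => /eqP ->; rewrite dvdn_add.
apply: saturated_of_blocks => A i AX iA /setUP[iD|iE]; rewrite subsetU //.
  by rewrite (saturated_block_sub satD AX iA iD).
by rewrite (saturated_block_sub satE AX iA iE) orbT.
Qed.

(** Stated above a partition [X] only: divisibility of sizes does not pass to intersections. *)
Lemma saturatedI X D E : saturated (elt X) D -> saturated (elt X) E ->
  saturated (elt X) (D :&: E).
Proof.
move=> satD satE; apply: saturated_of_blocks => A i AX iA /setIP[iD iE].
by rewrite subsetI (saturated_block_sub satD AX iA iD) (saturated_block_sub satE AX iA iE).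
Qed.

Lemma saturated_block x P B : (x <= elt P)%O -> B \in ddblocks P -> saturated x B.
Proof.
case: x => [X|_ BP]; last exact: ddpart_dvd BP.
move/refinesP=> XP BP; apply: saturated_of_blocks => A i AX iA iB.
have [C CP /subsetP AC] := XP A AX.
by rewrite (same_block (ddpartP P) BP CP iB (AC i iA)); apply/subsetP.
Qed.

Lemma split_le_self P Q B D : cut P B D -> ddblocks Q = split_block P B D ->
  (elt Q <= elt P)%O.
Proof.
case/and4P=> BP DB _ _ eQ; apply/refinesP => C; rewrite eQ in_split.
case/or3P=> [/eqP ->|/eqP ->|/andP[_ CP]]; first by exists B.
  by exists B; rewrite ?subsetDl.
by exists C.
Qed.

Lemma split_lt P Q B D : cut P B D -> ddblocks Q = split_block P B D ->
  (elt Q < elt P)%O.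
Proof.
move=> cutB eQ; rewrite lt_neqAle (split_le_self cutB eQ) andbT.
have /and4P[BP DB D0 DneqB] := cutB.
apply/eqP => -[eQP]; have := notin_split BP DB D0 DneqB.
by rewrite -eQ eQP BP.
Qed.

(** Blocks of [x] inside [B] must fit in one of the two pieces, which is saturation; when [x] is the
    bottom, saturation of [D] is the divisibility that [Q] guarantees. *)
Lemma le_split x P Q B D : cut P B D -> ddblocks Q = split_block P B D ->
  (x <= elt Q)%O = (x <= elt P)%O && saturated x D.
Proof.
move=> cutB eQ; have /and4P[BP DB D0 DneqB] := cutB.
have DQ : D \in ddblocks Q by rewrite eQ in_split eqxx.
apply/idP/andP => [xQ|[xP satD]].
  by rewrite (le_trans xQ (split_le_self cutB eQ)) (saturated_block xQ).
case: x xP satD => [X|//] /refinesP XP satD; apply/refinesP => A AX.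
have [C CP AC] := XP A AX; case: (eqVneq C B) => [eCB|CneqB].
  case/saturatedP/(_ A AX): satD => AD; first by exists D.
  by exists (B :\: D); rewrite ?eQ ?in_split ?eqxx ?orbT// subsetD -eCB AC.
by exists C; rewrite // eQ in_split CneqB CP !orbT.
Qed.

Lemma exists_split x P B D : cut P B D -> saturated x D ->
  exists Q, ddblocks Q = split_block P B D.
Proof.
move=> cutB satD; have /and4P[BP DB D0 DneqB] := cutB.
suff ddQ : is_ddpart d (split_block P B D) by exists (DDPart ddQ).
rewrite /is_ddpart (partition_split (ddpartP P))//=.
apply/forallP => C; apply/implyP; rewrite in_split.
case/or3P=> [/eqP ->|/eqP ->|/andP[_ CP]]; last exact: ddpart_dvd CP.
  exact: saturated_dvd satD.
by rewrite cardsD (setIidPr DB) dvdn_sub ?(ddpart_dvd BP) ?(saturated_dvd satD).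
Qed.

(** If all blocks of [Q] were blocks of [P], the partitions would agree; so some block [A] of [Q] is
    a proper part of a block of [P]. *)
Lemma lt_exists_cut P Q : (elt Q < elt P)%O ->
  exists B A, cut P B A /\ A \in ddblocks Q.
Proof.
move=> QltP; have /refinesP QP : refines Q P := ltW QltP.
have [QsubP|/subsetPn[A AQ AP]] := boolP (ddblocks Q \subset ddblocks P).
  case/negP: (lt_geF QltP).
  have : refines P Q.
    apply/refinesP => B BP; have /set0Pn[i iB] := block_neq0 (ddpartP P) BP.
    have [A AQ iA] := block_of (ddpartP Q) i; exists A => //.
    by rewrite (same_block (ddpartP P) BP (subsetP QsubP A AQ) iB iA).
  by move=> PQ; rewrite elt_le PQ.
have [B BP AB] := QP A AQ; exists B, A; split=> //.
rewrite /cut BP AB (block_neq0 (ddpartP Q) AQ) /=.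
by apply: contraNneq AP => ->.
Qed.

(** Splitting a block [A] of [Q] off [B] gives an element of [[Q, P)], which the covering identifies
    with [Q]. *)
Lemma covers_exists_split P Q : covers (elt P) (elt Q) ->
  exists B D, cut P B D /\ ddblocks Q = split_block P B D.
Proof.
move=> cov; have [B [A [cutB AQ]]] := lt_exists_cut (covers_lt cov).
have satA : saturated (elt Q) A := saturated_block (lexx _) AQ.
have [R eR] := exists_split cutB satA; exists B, A; split=> //.
have QR : (elt Q <= elt R)%O by rewrite (le_split _ cutB eR) (ltW (covers_lt cov)).
case: (eqVneq (elt Q) (elt R)) => [[->] //|neq].
case: (covers_between cov _ (split_lt cutB eR)).
by rewrite lt_neqAle neq QR.
Qed.

(** Some block [A] of an intermediate [R] properly cuts a block of [P]. As a union of blocks of [Q],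
    it can only be one of the two pieces of [B], so splitting it off gives [Q] again, although the
    result lies above [R]. *)
Lemma covers_split P Q B D : cut P B D -> ddblocks Q = split_block P B D ->
  covers (elt P) (elt Q).
Proof.
move=> cutB eQ; rewrite /covers (split_lt cutB eQ).
apply/forallP => -[R|//]; apply/negP => /andP[QR RP].
have [C [A [cutC' AR]]] := lt_exists_cut RP.
have /and4P[CP AC A0 AneqC] := cutC'; have /and4P[BP DB D0 DneqB] := cutB.
have satA : saturated (elt Q) A := saturated_block (ltW QR) AR.
have [S eS] := exists_split cutC' (saturated_block (lexx _) AR).
have RS : (elt R <= elt S)%O.
  by rewrite (le_split _ cutC' eS) (ltW RP) (saturated_block (lexx _) AR).
suff eSQ : ddblocks S = ddblocks Q.
  by have := lt_le_trans QR RS; rewrite (elt_inj eSQ) ltxx.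
have eqCB : C = B.
  apply/eqP; apply/idPn => CneqB; have CQ : C \in ddblocks Q.
    by rewrite eQ in_split CneqB CP !orbT.
  have /set0Pn[i iA] := A0.
  have := saturated_block_sub satA CQ (subsetP AC i iA) iA => CA.
  by case/eqP: AneqC; apply/eqP; rewrite eqEsubset AC.
have DQ : D \in ddblocks Q by rewrite eQ in_split eqxx.
have EQ : B :\: D \in ddblocks Q by rewrite eQ in_split eqxx orbT.
rewrite eS eQ eqCB; rewrite eqCB in AC AneqC.
have /saturatedP satA' := satA.
(* Containing both pieces, [A] would be [B]; containing neither, it would be empty. *)
case: (satA' _ DQ) => [DA|dDA]; case: (satA' _ EQ) => [EA|dEA].
- case/eqP: AneqC; apply/eqP; rewrite eqEsubset AC.
  by rewrite -(setID B D) subUset EA subIset ?DA ?orbT.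
- suff -> : A = D by [].
  apply/eqP; rewrite eqEsubset DA andbT; apply/subsetP => i iA.
  move/pred0P/(_ i): dEA; rewrite /= !inE iA (subsetP AC)// !andbT.
  by move/negbFE.
- suff -> : A = B :\: D by rewrite split_blockC.
  by apply/eqP; rewrite eqEsubset EA andbT subsetD AC disjoint_sym.
- have /set0Pn[i iA] := A0; have iB := subsetP AC i iA.
  move/pred0P/(_ i): dDA; move/pred0P/(_ i): dEA.
  by rewrite /= !inE iA iB !andbT => /negbFE ->.
Qed.

(** The members of the picked pair are merged in [P], so neither is a block of [P]. The only such
    blocks of [Q] are the two pieces of [B], and the maxima fix their order. *)
Lemma ddlabel_split P Q B D : cut P B D -> ddblocks Q = split_block P B D ->
  block_max D < block_max (B :\: D) ->
  ddlabel (elt P) (elt Q) = split_label D (B :\: D).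
Proof.
move=> cutB eQ ltDE; have /and4P[BP DB D0 DneqB] := cutB.
have DP := notin_of_split (ddpartP P) BP DB D0 DneqB.
have /and4P[_ EB E0 EneqB] := cutC cutB.
have EP := notin_of_split (ddpartP P) BP EB E0 EneqB.
have DE : D :|: (B :\: D) = B by rewrite -[in RHS](setID B D) (setIidPr DB).
have DneqE : B :\: D != D by apply: contraTneq ltDE => ->; rewrite ltnn.
rewrite /ddlabel /=; case: pickP => [[B1 B2] /and4P[/= B1Q B2Q lt12 /eqP eP]|]; last first.
  (* The pick succeeds, since [(D, B :\: D)] is a merge pair. *)
  move/(_ (D, B :\: D)); rewrite /is_merge /= ltDE eQ !in_split !eqxx orbT /= => /negP[].
  rewrite DE; apply/eqP/setP => C; rewrite !inE.
  case: (eqVneq C B) => [->|CB] //=; case: (eqVneq C (B :\: D)) => [->|CE] /=.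
    exact: negbTE.
  by case: (eqVneq C D) => [->|CD] //=; rewrite (negbTE DP).
have B12 : B1 != B2 by apply: contraTneq lt12 => ->; rewrite ltnn.
have p0 := block_neq0 (ddpartP Q).
have dB12 i : i \in B1 -> i \in B2 -> False.
  by move=> i1 i2; case/eqP: B12; have := same_block (ddpartP Q) B1Q B2Q i1 i2.
have B1P : B1 \notin ddblocks P.
  rewrite eP !inE eqxx andbF orbF; apply/eqP => /setP e.
  have /set0Pn[i i2] := p0 _ B2Q; apply: (dB12 i) => //.
  by rewrite e inE i2 orbT.
have B2P : B2 \notin ddblocks P.
  rewrite eP !inE eqxx orbF; apply/eqP => /setP e.
  have /set0Pn[i i1] := p0 _ B1Q; apply: (dB12 i) => //.
  by rewrite e inE i1.
have side C : C \in ddblocks Q -> C \notin ddblocks P -> C = D \/ C = B :\: D.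
  by rewrite eQ in_split => /or3P[/eqP ->|/eqP ->|/andP[_ ->]] //; [left|right].
case: (side _ B1Q B1P) (side _ B2Q B2P) => [e1|e1] [e2|e2]; subst B1 B2 => //.
- by rewrite eqxx in B12.
- by have := ltn_trans ltDE lt12; rewrite ltnn.
- by rewrite eqxx in B12.
Qed.

Lemma ddlabel_bot P : ddlabel (elt P) bot = 0%R.
Proof. by []. Qed.

Lemma split_cover x P B D : (x <= elt P)%O -> cut P B D -> saturated x D ->
  exists2 Q, ddblocks Q = split_block P B D & cover_in x (elt P) (elt Q).
Proof.
move=> xP cutB satD; have [Q eQ] := exists_split cutB satD; exists Q => //.
by rewrite /cover_in (covers_split cutB eQ) (le_split _ cutB eQ) xP.
Qed.

Lemma block_max_cut P B D : cut P B D -> block_max D != block_max (B :\: D).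
Proof.
move=> cutB; have /and4P[_ DB D0 _] := cutB; have /and4P[_ EB E0 _] := cutC cutB.
have [i iD ->] := block_max_attained D0; have [j jE ->] := block_max_attained E0.
by apply/eqP => -[/val_inj eij]; move: jE; rewrite -eij inE iD.
Qed.

(** Of the two pieces, [D] is chosen with the smaller maximum, as [ddlabel_split] requires. *)
Lemma cover_split x P Q : cover_in x (elt P) (elt Q) -> exists B D,
  [/\ cut P B D, saturated x D, block_max D < block_max (B :\: D)
    & ddblocks Q = split_block P B D].
Proof.
case/andP=> /covers_exists_split[B [D [cutB eQ]]].
rewrite (le_split _ cutB eQ) => /andP[xP satD].
have /and4P[BP DB _ _] := cutB.
case: (ltngtP (block_max D) (block_max (B :\: D))) => [lt|lt|eq].
- by exists B, D.
- exists B, (B :\: D); rewrite split_blockC//; split=> //; first exact: cutC.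
    by apply: saturatedD => //; apply: saturated_block xP BP.
  by rewrite setDDr setDv set0U (setIidPr DB).
- by have := block_max_cut cutB; rewrite eq eqxx.
Qed.

End Lattice.

(** * Steps below a partition, and the step to the bottom *)

Section Steps.
Context {d n : nat}.
Implicit Types (i j : 'I_n) (A B C D E I : {set 'I_n}) (P Q X : ddpart d n).
Implicit Types (x y z t : ddlattice d n).

Lemma block_max_gt0 B : B != set0 -> 0 < block_max B.
Proof. by case/block_max_attained=> i _ ->. Qed.

Lemma ltn_max_min_max D E :
  E != set0 -> block_max D < block_min E -> block_max D < block_max E.
Proof.
case/set0Pn=> j jE; have := block_min_leq jE; have := mem_ltn_block_max jE; lia.
Qed.

Lemma split_label_below D E : block_max D < block_min E ->
  split_label D E = (- Posz (block_max D))%R.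
Proof. by rewrite /split_label => ->. Qed.

Lemma split_label_ge D E : (- Posz (block_max D) <= split_label D E)%R.
Proof. by rewrite /split_label; case: ifP; lia. Qed.

Lemma split_label_le D E : (split_label D E <= Posz (block_max D))%R.
Proof. by rewrite /split_label; case: ifP; lia. Qed.

Lemma cut_neq0 P B D : cut P B D -> D != set0.
Proof. by case/and4P. Qed.

Lemma cut_sub P B D : cut P B D -> D \subset B.
Proof. by case/and4P. Qed.

Lemma cut_block P B D : cut P B D -> B \in ddblocks P.
Proof. by case/and4P. Qed.

Lemma cut_lt_block_max P B D :
  cut P B D -> block_max D < block_max (B :\: D) -> block_max (B :\: D) = block_max B.
Proof.
move=> /cut_sub DB lt; have := block_maxU D (B :\: D).
by rewrite -{1}(setIidPr DB) setID => ->; apply/esym/maxn_idPr/ltnW.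
Qed.

Lemma cut_block_max P B D :
  cut P B D -> block_max D < block_max B -> block_max D < block_max (B :\: D).
Proof.
move=> /cut_sub DB; have := block_maxU D (B :\: D).
by rewrite -{1}(setIidPr DB) setID => ->; rewrite leq_max ltnn.
Qed.

Lemma split_step x P B D : (x <= elt P)%O -> cut P B D -> saturated x D ->
  block_max D < block_max (B :\: D) ->
  exists Q, [/\ ddblocks Q = split_block P B D, cover_in x (elt P) (elt Q)
              & ddlabel (elt P) (elt Q) = split_label D (B :\: D)].
Proof.
move=> xP cutB satD lt; have [Q eQ cQ] := split_cover xP cutB satD.
by exists Q; rewrite (ddlabel_split cutB eQ).
Qed.

Lemma below_step x P B D : (x <= elt P)%O -> cut P B D -> saturated x D ->
  block_max D < block_min (B :\: D) ->
  exists2 Q, cover_in x (elt P) (elt Q)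
           & ddlabel (elt P) (elt Q) = (- Posz (block_max D))%R.
Proof.
move=> xP cutB satD lt; have E0 := cut_neq0 (cutC cutB).
have [Q [_ cQ lQ]] := split_step xP cutB satD (ltn_max_min_max E0 lt).
by exists Q => //; rewrite lQ split_label_below.
Qed.

(** The common maximum lies in one block only, and an initial segment of a block is determined by
    its last element. *)
Lemma below_cut_inj P B D B' D' : cut P B D -> cut P B' D' ->
  block_max D < block_min (B :\: D) -> block_max D' < block_min (B' :\: D') ->
  block_max D = block_max D' -> B = B' /\ D = D'.
Proof.
move=> cutB cutB' lt lt' eqm.
have [i iD ei] := block_max_attained (cut_neq0 cutB).
have [i' iD' ei'] := block_max_attained (cut_neq0 cutB').
have eii : i = i' by apply: val_inj => /=; lia.
rewrite -{i'}eii in iD' ei'.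
have eB : B = B'.
  apply: (same_block (ddpartP P) (cut_block cutB) (cut_block cutB')).
    exact: subsetP (cut_sub cutB) _ iD.
  exact: subsetP (cut_sub cutB') _ iD'.
rewrite -{B'}eB in cutB' lt' *; split=> //.
have below D1 j : cut P B D1 -> block_max D1 < block_min (B :\: D1) ->
    i \in D1 -> block_max D1 = i.+1 -> (j \in D1) = (j \in B) && (j <= i).
  move=> cut1 lt1 i1 e1; have sub := subsetP (cut_sub cut1) j.
  apply/idP/andP=> [j1|[jB ji]]; first by rewrite sub //; have := mem_ltn_block_max j1; lia.
  apply/idPn => j1; have jE : j \in B :\: D1 by rewrite inE j1.
  by have := ltn_max_minP (cut_neq0 cut1) (cut_neq0 (cutC cut1)) lt1 i j i1 jE; lia.
by apply/setP => j; rewrite (below D)// (below D').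
Qed.

Lemma not_covers_bot x P Q : cover_in x (elt P) (elt Q) -> ~~ covers (elt P) bot.
Proof.
case/andP=> /covers_lt QP _; apply/negP => cb.
exact: covers_between cb (bot_lt Q) QP.
Qed.

(** The first [d] elements of [B] are split off. *)
Lemma exists_below_cut P B : 0 < d -> B \in ddblocks P -> #|B| != d ->
  exists D, [/\ cut P B D, d %| #|D| & block_max D < block_min (B :\: D)].
Proof.
move=> d0 BP Bd; have B0 : 0 < #|B| by rewrite card_gt0 (block_neq0 (ddpartP P)).
have dB := dvdn_leq B0 (ddpart_dvd BP).
have [D [DB cD lt]] := exists_initial_segment dB.
have D0 : D != set0 by rewrite -card_gt0 cD.
have cutB : cut P B D.
  by rewrite /cut BP DB D0; apply: contraNneq Bd => <-; rewrite cD.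
exists D; rewrite cutB cD; split=> //; apply/ltn_max_minP => //.
exact: cut_neq0 (cutC cutB).
Qed.

(** A cut of a block of size [d] would leave a nonempty piece of size divisible by [d] and less than
    [d]. *)
Lemma covers_bot P : (forall B, B \in ddblocks P -> #|B| = d) -> covers (elt P) bot.
Proof.
move=> Pd; rewrite /covers bot_lt; apply/forallP => -[R|//]; apply/negP => /andP[_ RP].
have [B [A [/and4P[BP AB A0 AneqB] AR]]] := lt_exists_cut RP.
have := proper_card (_ : A \proper B); rewrite properEneq AneqB AB => /(_ isT).
by rewrite (Pd B BP) ltnNge dvdn_leq ?card_gt0 ?(ddpart_dvd AR).
Qed.

(** Nothing else is covered by [y], since every partition lies above the bottom. *)
Lemma least_step_bot x y : least_step (@ddlabel d n) x y bot ->
    [/\ (forall t, cover_in x y t -> ddlabel y t = ddlabel y bot -> t = bot),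
        (forall t, cover_in x bot t -> (ddlabel y bot <= ddlabel bot t)%R)
      & (forall t, cover_in x y t -> t != bot ->
           exists2 u, cover_in x t u & (ddlabel t u < ddlabel y t)%R)].
Proof.
case=> /andP[yb xb] _.
have only t : cover_in x y t -> t = bot.
  case: t => [Q|//] /andP[/covers_lt Qy _].
  by case: (covers_between yb (bot_lt Q) Qy).
split=> [t /only //|t /andP[/covers_lt tb]|t /only ->]; last by rewrite eqxx.
by have := lt_geF tb; rewrite bot_le.
Qed.

(** * The least label is negative *)

Section NegativeStep.
Variables (x : ddlattice d n) (P Q : ddpart d n) (B I : {set 'I_n}).
Hypotheses (d_gt0 : 0 < d) (cutI : cut P B I) (satI : saturated x I)
  (ltI : block_max I < block_min (B :\: I))
  (eQ : ddblocks Q = split_block P B I) (cQ : cover_in x (elt P) (elt Q))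
  (minI : forall t, cover_in x (elt P) t ->
     (- Posz (block_max I) <= ddlabel (elt P) t)%R).

Let xP : (x <= elt P)%O.
Proof. by have /andP[/covers_lt/ltW QP /le_trans] := cQ; apply. Qed.

Let xQ : (x <= elt Q)%O.
Proof. by case/andP: cQ. Qed.

Let I_lt_J i j : i \in I -> j \in B :\: I -> i < j.
Proof. exact: ltn_max_minP (cut_neq0 cutI) (cut_neq0 (cutC cutI)) ltI i j. Qed.

(** A negative label marks an initial segment, and such a cut is determined by its maximum. *)
Lemma negative_step_inj t : cover_in x (elt P) t ->
  ddlabel (elt P) t = (- Posz (block_max I))%R -> t = elt Q.
Proof.
case: t => [R|] ct; last by case/andP: ct; rewrite (negbTE (not_covers_bot cQ)).
have [B' [D' [cutD satD ltD eR]]] := cover_split ct.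
rewrite (ddlabel_split cutD eR ltD) /split_label.
have := block_max_gt0 (cut_neq0 cutI); case: ifP => [lt _ [em]|_]; last by clear; lia.
have [|eB eD] := below_cut_inj cutI cutD ltI lt; first by move: em; clear; lia.
by apply: elt_inj; rewrite eR eQ eB eD.
Qed.

(** A cut of [I] has label at least [- block_max I]. A cut of [B :\: I] with negative label becomes,
    on adding [I], a cut of [B] with the same label; a cut of any other block is available in [P]
    already. Both are bounded by [minI]. *)
Lemma negative_step_incr t : cover_in x (elt Q) t ->
  (- Posz (block_max I) <= ddlabel (elt Q) t)%R.
Proof.
case: t => [R|] ct; last by rewrite ddlabel_bot oppr_le0.
have [C [C1 [cutD satC lt eR]]] := cover_split ct.
rewrite (ddlabel_split cutD eR lt).
have := cut_block cutD; rewrite eQ in_split; case/or3P=> [/eqP eC|/eqP eC|/andP[CB CP]].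
- apply: le_trans (split_label_ge _ _); rewrite lerN2 lez_nat block_max_mono//.
  by rewrite -eC (cut_sub cutD).
- rewrite /split_label; case: ifP => [ltC|_]; last first.
    by move: (block_max I) (block_max C1) => a b; clear; lia.
  have E0 := cut_neq0 (cutC cutD).
  have eE : B :\: (I :|: C1) = C :\: C1 by rewrite eC setDDl.
  have CB : C1 \subset B by rewrite (subset_trans (cut_sub cutD))// eC subsetDl.
  have cutU : cut P B (I :|: C1).
    rewrite /cut (cut_block cutI) subUset (cut_sub cutI) CB /= setU_eq0.
    rewrite (negbTE (cut_neq0 cutI)) /=; apply: contraNneq E0 => eU.
    by rewrite -eE eU setDv.
  have satU : saturated x (I :|: C1).
    apply: saturatedU => //; rewrite -setI_eq0; apply/eqP/setP => i.
    rewrite !inE; apply/negP => /andP[iI /(subsetP (cut_sub cutD))].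
    by rewrite eC inE iI.
  have [i iI ei] := block_max_attained (cut_neq0 cutI).
  have [j jC ej] := block_max_attained (cut_neq0 cutD).
  have ij : i < j by apply: I_lt_J; rewrite // -eC (subsetP (cut_sub cutD)).
  have eU : block_max (I :|: C1) = block_max C1.
    by rewrite block_maxU; apply/maxn_idPr; rewrite ei ej ltnS ltnW.
  have ltU : block_max (I :|: C1) < block_min (B :\: (I :|: C1)) by rewrite eU eE.
  have [S cS lS] := below_step xP cutU satU ltU.
  by have := minI cS; rewrite lS eU.
- have cutP : cut P C C1 by case/and4P: cutD => _ *; apply/and4P; split.
  have [S [_ cS lS]] := split_step xP cutP satC lt.
  by have := minI cS; rewrite lS.
Qed.

Lemma negative_step_descent t : cover_in x (elt P) t -> t != elt Q ->
  exists2 u, cover_in x t u & (ddlabel t u < ddlabel (elt P) t)%R.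
Proof.
case: t => [R|] ct neq; last by case/andP: ct; rewrite (negbTE (not_covers_bot cQ)).
rewrite -/(elt R) in ct neq *.
have ltl : (- Posz (block_max I) < ddlabel (elt P) (elt R))%R.
  rewrite lt_neqAle minI // andbT eq_sym.
  by apply: contraNN neq => /eqP e; apply/eqP/negative_step_inj.
have xR : (_ <= elt R)%O := proj2 (andP ct).
have [B' [D [cutD satD ltD eR]]] := cover_split ct.
have lR := ddlabel_split cutD eR ltD.
(* If another block was cut, [I] can still be split off [B]. *)
have [eB|neB] := eqVneq B' B; last first.
  have cutR : cut R B I.
    case/and4P: cutI => BP IB I0 IneB; apply/and4P; split=> //.
    by rewrite eR in_split BP [B == B']eq_sym neB !orbT.
  by have [S cS lS] := below_step xR cutR satI ltI; exists (elt S); rewrite // lS.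
subst B'; set E := B :\: D in ltD lR.
have DR : D \in ddblocks R by rewrite eR in_split eqxx.
have ER : E \in ddblocks R by rewrite eR in_split eqxx orbT.
have DB := cut_sub cutD; have IB := cut_sub cutI.
have D0 := cut_neq0 cutD; have E0 : E != set0 := cut_neq0 (cutC cutD).
have J0 := cut_neq0 (cutC cutI).
have satE : saturated x E by apply: saturated_block xR ER.
(* An initial segment [D] with label above [- block_max I] lies properly inside [I]; then [I :\: D]
   splits off [E] with label [- block_max I]. *)
have [ltDE|geDE] := boolP (block_max D < block_min E).
  move: ltl; rewrite lR split_label_below // ltrN2 ltz_nat => ltl.
  have [i iI ei] := block_max_attained (cut_neq0 cutI).
  have iD : i \notin D.
    by apply/negP => /mem_ltn_block_max; move: ltl; rewrite ei ltnS leqNgt => /negP.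
  have DI : D \subset I.
    apply/subsetP => j jD; apply/idPn => jI.
    have jJ : j \in B :\: I by rewrite inE jI (subsetP DB).
    by move: (I_lt_J iI jJ) (mem_ltn_block_max jD) ltl ei; clear; lia.
  have eE : E :\: (I :\: D) = B :\: I.
    apply/setP => j; rewrite !inE; have := subsetP DI j.
    by case: (j \in D) => //= ->.
  have cutR : cut R E (I :\: D).
    apply/and4P; split=> //; first exact: setSD.
      by apply/set0Pn; exists i; rewrite inE iD.
    by apply: contraNneq J0 => e; rewrite -eE e setDv.
  have eI : block_max (I :\: D) = block_max I.
    have := block_maxU D (I :\: D).
    by rewrite -{1}(setIidPr DI) setID => e; move: e ltl; clear; lia.
  have [|S cS lS] := below_step xR cutR (saturatedD DI satI satD).
    by rewrite eE eI.
  by exists (elt S); rewrite // lS eI ltrN2 ltz_nat.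
have {}lR : ddlabel (elt P) (elt R) = Posz (block_max D).
  by rewrite lR /split_label (negbTE geDE).
have D_gt0 := block_max_gt0 D0.
(* The label of the step to [R] is now positive, so any negative label below [R] suffices. *)
have descend C F : cut R C F -> saturated x F -> block_max F < block_min (C :\: F) ->
    exists2 u, cover_in x (elt R) u & (ddlabel (elt R) u < ddlabel (elt P) (elt R))%R.
  move=> cutF satF ltF; have [S cS lS] := below_step xR cutF satF ltF.
  by exists (elt S); rewrite // lS lR; move: D_gt0; clear; lia.
case: x xR satI satD satE descend => [X|] xR satI' satD' satE' descend; last first.
  (* Over the bottom, either all blocks have size [d] and the final label 0 is smaller, or an
     initial segment of some block splits off. *)
  have [Rd|] := boolP [forall C in ddblocks R, #|C| == d].
    exists bot; rewrite ?ddlabel_bot ?lR //; apply/andP; split=> //.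
    by apply: covers_bot => C CR; apply/eqP; have /forallP/(_ C)/implyP := Rd; apply.
  case/forallPn=> C; rewrite negb_imply => /andP[CR Cd].
  have [F [cutF satF ltF]] := exists_below_cut d_gt0 CR Cd.
  exact: descend cutF satF ltF.
(* A block inside [B] that meets both [I] and [B :\: I] is cut along [I]. *)
have straddle C : C \in ddblocks R -> C \subset B -> C :&: I != set0 -> C :\: I != set0 ->
    exists2 u, cover_in (elt X) (elt R) u & (ddlabel (elt R) u < ddlabel (elt P) (elt R))%R.
  move=> CR CB CI CJ; have eC : C :\: (C :&: I) = C :\: I by rewrite setDIr setDv set0U.
  apply: (descend C (C :&: I)).
  - rewrite /cut CR subsetIl CI /=; apply: contraNneq CJ => e.
    by rewrite -eC e setDv.
  - by apply: saturatedI => //; apply: saturated_block xR CR.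
  - rewrite eC; apply/ltn_max_minP => // i j /setIP[_ iI] /setDP[jC jI].
    by apply: I_lt_J; rewrite // inE jI (subsetP CB).
(* If [D] meets [I], either [D] straddles or it lies inside [I]. In the latter case [E] straddles,
   for otherwise [D] would be [I] and [R] would be [Q]. *)
have [/(straddle D DR DB)|DI] := boolP (D :&: I != set0).
  have [_ /(_ isT)//|] := boolP (D :\: I != set0); rewrite negbK setD_eq0 => DI _.
  have [/(straddle E ER (subsetDl _ _))|] := boolP (E :&: I != set0).
    apply; apply: contraNneq J0 => /eqP; rewrite setD_eq0 => EI.
    by rewrite setD_eq0 -(setID B D) subUset EI subIset ?DI ?orbT.
  rewrite negbK => /eqP EI; case/eqP: neq; apply: elt_inj; rewrite eR eQ.
  suff -> : D = I by [].
  apply/eqP; rewrite eqEsubset DI; apply/subsetP => i iI; apply/idPn => iD.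
  by move/setP/(_ i): EI; rewrite !inE iI iD (subsetP IB).
(* If [D] misses [I], then [E] contains [I] and straddles: [E] equal to [I] would put the larger
   maximum in [D]. *)
rewrite negbK in DI; have IE : I \subset E.
  by rewrite subsetD IB -setI_eq0 setIC.
apply: (straddle E) => //; first exact: subsetDl.
  by rewrite (setIidPr IE) (cut_neq0 cutI).
apply/negP; rewrite setD_eq0 => EI.
have [i iD ei] := block_max_attained D0.
have [j jE ej] := block_max_attained E0.
have ji : j < i.
  apply: I_lt_J; first exact: subsetP EI j jE.
  rewrite inE (subsetP DB _ iD) andbT; apply/negP => iI.
  by move/eqP/setP/(_ i): DI; rewrite !inE iD iI.
by move: ji ltD; rewrite ei ej; clear; lia.
Qed.

End NegativeStep.

(** * The least label is positive *)

Section PositiveStep.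
Variables (X P Q : ddpart d n) (B I : {set 'I_n}).
Hypotheses (cutI : cut P B I) (satI : saturated (elt X) I)
  (ltI : block_max I < block_max (B :\: I))
  (eQ : ddblocks Q = split_block P B I) (cQ : cover_in (elt X) (elt P) (elt Q))
  (minI : forall t, cover_in (elt X) (elt P) t ->
     (Posz (block_max I) <= ddlabel (elt P) t)%R).

Let xP : (elt X <= elt P)%O.
Proof. by have /andP[/covers_lt/ltW QP /le_trans] := cQ; apply. Qed.

Let xQ : (elt X <= elt Q)%O.
Proof. by case/andP: cQ. Qed.

Lemma saturated_self_block A : A \in ddblocks X -> saturated (elt X) A.
Proof. exact: saturated_block (lexx _). Qed.

(** The label of this cut is at most [block_max D], and [minI] bounds it from below. *)
Lemma positive_step_min C D : cut P C D -> saturated (elt X) D ->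
  block_max D < block_max C -> block_max I <= block_max D.
Proof.
move=> cutD satD lt; have ltD := cut_block_max cutD lt.
have [S [_ cS lS]] := split_step xP cutD satD ltD.
by have := le_trans (minI cS); rewrite lS => /(_ _ (split_label_le _ _)).
Qed.

(** Such a cut would have a negative label, below the least one. *)
Lemma positive_step_not_below C D : cut P C D -> saturated (elt X) D ->
  ~~ (block_max D < block_min (C :\: D)).
Proof.
move=> cutD satD; apply/negP => lt; have [S cS lS] := below_step xP cutD satD lt.
by have := minI cS; have := block_max_gt0 (cut_neq0 cutI); rewrite lS; clear; lia.
Qed.

(** Each block of [X] inside [D] can be split off as well, so by minimality its maximum is
    [block_max I]; distinct blocks cannot share a maximum. *)
Lemma positive_step_lower C D : cut P C D -> saturated (elt X) D ->
  block_max D < block_max C -> block_max D = block_max I -> D \in ddblocks X.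
Proof.
move=> cutD satD ltD em; have DC := cut_sub cutD.
have minA A : A \in ddblocks X -> A \subset D -> block_max A = block_max I.
  move=> AX AD; have le := block_max_mono AD.
  have cutA : cut P C A.
    rewrite /cut (cut_block cutD) (subset_trans AD DC) (block_neq0 (ddpartP X) AX) /=.
    by apply: contraTneq ltD => <-; rewrite -leqNgt.
  have := positive_step_min cutA (saturated_self_block AX) (leq_ltn_trans le ltD) => le'.
  by apply/eqP; rewrite eqn_leq le' -em le.
have [i iD ei] := block_max_attained (cut_neq0 cutD).
have [A AX iA] := block_of (ddpartP X) i.
have AD := saturated_block_sub satD AX iA iD.
suff -> : D = A by [].
apply/eqP; rewrite eqEsubset AD andbT; apply/subsetP => j jD.
have [A' AX' jA'] := block_of (ddpartP X) j.
have AD' := saturated_block_sub satD AX' jA' jD.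
have [k kA' ek] := block_max_attained (block_neq0 (ddpartP X) AX').
have eki : k = i by apply: val_inj; by have := minA _ AX' AD'; rewrite -em ei ek => -[].
by rewrite (same_block (ddpartP X) AX AX' iA) // -eki.
Qed.

Let ltIB : block_max I < block_max B.
Proof. by rewrite -(cut_lt_block_max cutI ltI). Qed.

Let IX : I \in ddblocks X.
Proof. exact: positive_step_lower cutI satI ltIB erefl. Qed.

(** By [positive_step_lower] both [D] and [I] are blocks of [X], and they share their maximum. *)
Lemma positive_step_inj t : cover_in (elt X) (elt P) t ->
  ddlabel (elt P) t = Posz (block_max I) -> t = elt Q.
Proof.
case: t => [R|] ct; last by case/andP: ct; rewrite (negbTE (not_covers_bot cQ)).
have [C [D [cutD satD ltD eR]]] := cover_split ct.
rewrite (ddlabel_split cutD eR ltD) /split_label.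
rewrite (negbTE (positive_step_not_below cutD satD)) => -[em].
have DX : D \in ddblocks X.
  by apply: (positive_step_lower cutD satD _ em); rewrite -(cut_lt_block_max cutD ltD).
have [i iI ei] := block_max_attained (cut_neq0 cutI).
have [j jD ej] := block_max_attained (cut_neq0 cutD).
have eij : j = i by apply: val_inj; move: em; rewrite ei ej => -[].
rewrite {j}eij in jD ej.
have eDI : D = I := same_block (ddpartP X) DX IX jD iI.
have eCB : C = B.
  apply: (same_block (ddpartP P) (cut_block cutD) (cut_block cutI)).
    exact: subsetP (cut_sub cutD) i jD.
  exact: subsetP (cut_sub cutI) i iI.
by apply: elt_inj; rewrite eR eQ eDI eCB.
Qed.

(** Being a block of [X], [I] cannot be cut. A piece [D] split off [B :\: I] can also be split off
    [B], so [block_max I <= block_max D]; were its label negative, [I :|: D] would be an initial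
    segment of [B], which [positive_step_not_below] excludes. Cuts of other blocks are available in
    [P]. *)
Lemma positive_step_incr t : cover_in (elt X) (elt Q) t ->
  (Posz (block_max I) <= ddlabel (elt Q) t)%R.
Proof.
case: t => [R|] ct; last by case/andP: ct.
have [C [D [cutD satD lt eR]]] := cover_split ct.
rewrite (ddlabel_split cutD eR lt).
have [DC D0 DneC] := let: And4 _ a b c := and4P cutD in And3 a b c.
have := cut_block cutD; rewrite eQ in_split; case/or3P=> [/eqP eC|/eqP eC|/andP[_ CP]].
- have /set0Pn[i iD] := D0; case/eqP: DneC; apply/eqP; rewrite eqEsubset DC.
  have iI : i \in I by rewrite -eC (subsetP DC).
  by rewrite eC (saturated_block_sub satD IX iI iD).
- have E0 := cut_neq0 (cutC cutD).
  have DB : D \subset B by rewrite (subset_trans DC)// eC subsetDl.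
  have DltC : block_max D < block_max B.
    by rewrite -(cut_lt_block_max cutI ltI) -eC -(cut_lt_block_max cutD lt).
  have cutDB : cut P B D.
    rewrite /cut (cut_block cutI) DB D0 /=.
    by apply: contraTneq DltC => ->; rewrite ltnn.
  have leI := positive_step_min cutDB satD DltC.
  rewrite /split_label; case: ifP => [ltD|//].
  have eE : B :\: (I :|: D) = C :\: D by rewrite eC setDDl.
  have cutU : cut P B (I :|: D).
    rewrite /cut (cut_block cutI) subUset (cut_sub cutI) DB /= setU_eq0.
    rewrite (negbTE (cut_neq0 cutI)) /=; apply: contraNneq E0 => eU.
    by rewrite -eE eU setDv.
  have satU : saturated (elt X) (I :|: D).
    apply: saturatedU => //; rewrite -setI_eq0; apply/eqP/setP => i.
    by rewrite !inE; apply/negP => /andP[iI /(subsetP DC)]; rewrite eC inE iI.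
  have := positive_step_not_below cutU satU.
  by rewrite eE block_maxU (maxn_idPr leI) ltD.
- have cutP : cut P C D by apply/and4P.
  have [S [_ cS lS]] := split_step xP cutP satD lt.
  by have := minI cS; rewrite lS.
Qed.

(** The block [I] of [X] lies properly inside one block of [R], and it splits off there with label
    at most [block_max I], which is less than the label of the step to [R]. *)
Lemma positive_step_descent t : cover_in (elt X) (elt P) t -> t != elt Q ->
  exists2 u, cover_in (elt X) t u & (ddlabel t u < ddlabel (elt P) t)%R.
Proof.
case: t => [R|] ct neq; last by case/andP: ct; rewrite (negbTE (not_covers_bot cQ)).
rewrite -/(elt R) in ct neq *.
have ltl : (Posz (block_max I) < ddlabel (elt P) (elt R))%R.
  rewrite lt_neqAle minI // andbT eq_sym.
  by apply: contraNN neq => /eqP e; apply/eqP/positive_step_inj.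
have xR : (_ <= elt R)%O := proj2 (andP ct).
have [C [D [cutD satD ltD eR]]] := cover_split ct.
have lR := ddlabel_split cutD eR ltD.
have peel F : F \in ddblocks R -> I \subset F -> block_max I < block_max F ->
    exists2 u, cover_in (elt X) (elt R) u & (ddlabel (elt R) u < ddlabel (elt P) (elt R))%R.
  move=> FR IF lt; have cutF : cut R F I.
    by rewrite /cut FR IF (cut_neq0 cutI); apply: contraTneq lt => ->; rewrite ltnn.
  have [S [_ cS lS]] := split_step xR cutF satI (cut_block_max cutF lt).
  by exists (elt S); rewrite // lS; apply: le_lt_trans (split_label_le _ _) ltl.
have [eC|neC] := eqVneq C B; last first.
  apply: (peel B) ltIB; last exact: cut_sub cutI.
  by rewrite eR in_split (cut_block cutI) [B == C]eq_sym neC !orbT.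
(* [I] lies inside [D] or avoids it. In the first case [block_max I < block_max D], because the
   label of the step to [R] is at most [block_max D]. *)
subst C; have /saturatedP/(_ I IX) [ID|dID] := satD.
  apply: (peel D) => //; first by rewrite eR in_split eqxx.
  by move: ltl; rewrite lR => /lt_le_trans/(_ (split_label_le _ _)); rewrite ltz_nat.
apply: (peel (B :\: D)); first by rewrite eR in_split eqxx orbT.
  by rewrite subsetD (cut_sub cutI).
by rewrite (cut_lt_block_max cutD ltD).
Qed.

End PositiveStep.
End Steps.

Theorem theorem3p7 (d n : nat) (d_gt1 : 1 < d) (n_gt0 : 0 < n) (dvd_dn : d %| n) :
  dual_EL_labeling (@ddlabel d n).
Proof.
have d_gt0 := ltnW d_gt1.
apply: dual_EL_of_least_step => x y [Q|]; last exact: least_step_bot.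
case: y => [P|] [cQ minQ]; last by case/andP: cQ => /covers_lt.
have [B [I [cutI satI ltI eQ]]] := cover_split cQ.
have xP : (x <= elt P)%O.
  by have /andP[/covers_lt/ltW QP /le_trans] := cQ; apply.
have lQ := ddlabel_split cutI eQ ltI.
rewrite -/(elt P) -/(elt Q) lQ; move: minQ; rewrite -/(elt P) -/(elt Q) lQ => minQ.
(* The case distinction is on the sign of the least label. *)
have [lt|ge] := boolP (block_max I < block_min (B :\: I)).
  rewrite split_label_below // in minQ *; split=> t.
  - exact: (negative_step_inj cutI lt eQ cQ).
  - exact: (negative_step_incr cutI satI lt eQ cQ minQ).
  - exact: (negative_step_descent d_gt0 cutI satI lt eQ cQ minQ).
have {}lQ : split_label I (B :\: I) = Posz (block_max I).
  by rewrite /split_label (negbTE ge).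
rewrite lQ in minQ *.
(* Over the bottom a positive least label is impossible: [B] has the proper piece [I] of size
   divisible by [d], so its first [d] elements split off with a negative label. *)
case: x xP cQ satI minQ => [X|] xP cQ satI minQ; last first.
  have Bd : #|B| != d.
    apply/eqP => Bd; have /and4P[_ IB I0 IneB] := cutI.
    have := proper_card (_ : I \proper B); rewrite properEneq IneB IB => /(_ isT).
    by rewrite Bd ltnNge dvdn_leq ?card_gt0.
  have [D [cutD satD ltD]] := exists_below_cut d_gt0 (cut_block cutI) Bd.
  have [S cS lS] := below_step xP cutD satD ltD.
  have := minQ _ cS; have := block_max_gt0 (cut_neq0 cutI); rewrite lS; clear; lia.
split=> t.
- exact: (positive_step_inj cutI satI ltI eQ cQ minQ).
- exact: (positive_step_incr cutI satI ltI eQ cQ minQ).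
- exact: (positive_step_descent cutI satI ltI eQ cQ minQ).
Qed.
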